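(* Let $\mathsf V$ be a pseudovariety of semigroups. The following are equivalent: (1) $\mathsf V$ is concatenation-closed; (2) for every alphabet $A$ (possibly infinite), if $K,L\subseteq A^+$ are $\mathsf V$-recognizable, then so is $KL$; (3) $\mathsf V\supseteq\mathsf N$ and the multiplication in $\overline{\Omega}_A\mathsf V$ is open for every alphabet $A$; (4) $\mathsf V\supseteq\mathsf N$ and the multiplication in $\overline{\Omega}_A\mathsf V$ is open for every finite alphabet $A$.
   Context: A pseudovariety of semigroups is a class of finite semigroups closed under subsemigroups, homomorphic images and finite direct products; $\mathsf N$ is the pseudovariety of finite nilpotent semigroups. For an alphabet (set) $A$, $A^+$ is the free semigroup and $\overline{\Omega}_A\mathsf V$ the free pro-$\mathsf V$ semigroup over $A$ (a compact semigroup that is an inverse limit of members of $\mathsf V$, with a map from $A$ such that every map from $A$ to a pro-$\mathsf V$ semigroup extends uniquely to a continuous homomorphism). A language $L\subseteq A^+$ is $\mathsf V$-recognizable if $L=\varphi^{-1}(\varphi(L))$ for some homomorphism $\varphi\colon A^+\to F$ with $F\in\mathsf V$. $\mathsf V$ is concatenation-closed if, for every finite alphabet $A$, the $\mathsf V$-recognizable languages over $A$ are closed under concatenation. Multiplication is open if it maps open subsets of $\overline{\Omega}_A\mathsf V\times\overline{\Omega}_A\mathsf V$ to open sets. *)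

(* Defs.v *)
From HB Require Import structures.
From mathcomp Require Import all_boot.
From mathcomp Require Import classical_sets topology.

Set Implicit Arguments.
Unset Strict Implicit.
Unset Printing Implicit Defensive.

Local Open Scope classical_set_scope.

Record finSemigroup := FinSemigroup {
  fs_car :> finType;
  fs_op : fs_car -> fs_car -> fs_car;
  fs_assoc : associative fs_op;
  fs_nonempty : 0 < #|fs_car| }.

Definition fs_hom (S T : finSemigroup) (f : S -> T) : Prop :=
  forall x y, f (fs_op x y) = fs_op (f x) (f y).

Definition prod_op (S T : finSemigroup) (p q : (S * T)%type) : (S * T)%type :=
  (fs_op p.1 q.1, fs_op p.2 q.2).

Lemma prod_op_assoc (S T : finSemigroup) : associative (@prod_op S T).
Proof. by move=> [a b] [c d] [e f]; rewrite /prod_op /= !fs_assoc. Qed.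

Lemma prod_nonempty (S T : finSemigroup) : 0 < #|{: (S * T)%type}|.
Proof. by rewrite card_prod muln_gt0 !fs_nonempty. Qed.

Definition prod_fs (S T : finSemigroup) : finSemigroup :=
  FinSemigroup (@prod_op_assoc S T) (prod_nonempty S T).

(* A pseudovariety: a class of finite semigroups closed under
   subsemigroups (injective homomorphic copies), homomorphic images and
   finite direct products (the empty product = trivial semigroup, and
   binary products). *)
Definition pseudovariety (V : finSemigroup -> Prop) : Prop :=
  [/\ (forall S T : finSemigroup, V S -> forall f : T -> S,
          fs_hom f -> injective f -> V T),
      (forall S T : finSemigroup, V S -> forall f : S -> T,
          fs_hom f -> (forall y, exists x, f x = y) -> V T),
      (forall T : finSemigroup, #|T| = 1 -> V T) &
      (forall S T : finSemigroup, V S -> V T -> V (prod_fs S T))].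

Definition nilpotent (S : finSemigroup) : Prop :=
  exists z : S, (forall x : S, fs_op z x = z /\ fs_op x z = z) /\
    exists n : nat, forall (x : S) (s : seq S), size s = n ->
      foldl (@fs_op S) x s = z.

Definition contains_N (V : finSemigroup -> Prop) : Prop :=
  forall S : finSemigroup, nilpotent S -> V S.

(* A nonempty word a :: s over A is represented as the pair (a, s). *)
Definition word (A : Type) : Type := (A * seq A)%type.

Definition wcat (A : Type) (u v : word A) : word A :=
  (u.1, u.2 ++ v.1 :: v.2).

Definition recognizable (V : finSemigroup -> Prop) (A : Type)
    (L : word A -> Prop) : Prop :=
  exists (F : finSemigroup) (phi : word A -> F),
    [/\ V F,
        (forall u v, phi (wcat u v) = fs_op (phi u) (phi v)) &
        (forall w, (exists u, L u /\ phi u = phi w) -> L w)].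

Definition lcat (A : Type) (K L : word A -> Prop) : word A -> Prop :=
  fun w => exists u v, [/\ K u, L v & w = wcat u v].

Definition concat_closed (V : finSemigroup -> Prop) : Prop :=
  forall (A : finType) (K L : word A -> Prop),
    recognizable V K -> recognizable V L -> recognizable V (lcat K L).

Definition concat_closed_all (V : finSemigroup -> Prop) : Prop :=
  forall (A : Type) (K L : word A -> Prop),
    recognizable V K -> recognizable V L -> recognizable V (lcat K L).

Record topSemigroup := TopSemigroup {
  ts_car :> topologicalType;
  ts_op : ts_car -> ts_car -> ts_car;
  ts_assoc : associative ts_op;
  ts_cont : continuous (fun p : ts_car * ts_car => ts_op p.1 p.2) }.

Definition ts_hom (S T : topSemigroup) (f : S -> T) : Prop :=
  forall x y, f (ts_op x y) = ts_op (f x) (f y).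

(* A pro-V semigroup: a compact semigroup S which is (topologically and
   algebraically) the inverse limit of an inverse system (F_i, f_ij) of
   members of V indexed by a nonempty directed preordered set I.  This is
   expressed through the limit cone pi_i : S -> F_i: the pi_i are
   continuous (F_i discrete) homomorphisms compatible with the bonding
   maps, the induced map from S into the set of threads is a bijection,
   and S carries the initial (= inverse limit) topology. *)
Definition proV (V : finSemigroup -> Prop) (S : topSemigroup) : Prop :=
  compact [set: S] /\
  exists (I : Type) (le : I -> I -> Prop) (F : I -> finSemigroup)
         (f : forall i j, le i j -> F j -> F i) (pi : forall i, S -> F i),
  [/\ [/\ inhabited I, (forall i, le i i),
          (forall i j k, le i j -> le j k -> le i k) &
          (forall i j, exists k, le i k /\ le j k)],
      [/\ (forall i, V (F i)),
          (forall i j (h : le i j), fs_hom (f i j h)),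
          (forall i (h : le i i) x, f i i h x = x) &
          (forall i j k (hij : le i j) (hjk : le j k) (hik : le i k) x,
              f i j hij (f j k hjk x) = f i k hik x)],
      [/\ (forall i x y, pi i (ts_op x y) = fs_op (pi i x) (pi i y)),
          (forall i (y : F i), open (pi i @^-1` [set y])) &
          (forall i j (h : le i j) x, f i j h (pi j x) = pi i x)],
      [/\ (forall x y : S, (forall i, pi i x = pi i y) -> x = y) &
          (forall t : forall i, F i,
              (forall i j (h : le i j), f i j h (t j) = t i) ->
              exists x : S, forall i, pi i x = t i)] &
      (forall U : set S, open U -> forall x, U x ->
          exists i, pi i @^-1` [set pi i x] `<=` U)].

Definition free_proV (V : finSemigroup -> Prop) (A : Type)
    (F : topSemigroup) (iota : A -> F) : Prop :=
  proV V F /\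
  forall (T : topSemigroup), proV V T -> forall g : A -> T,
    exists! h : F -> T, [/\ continuous h, ts_hom h & forall a, h (iota a) = g a].

Definition open_mult (F : topSemigroup) : Prop :=
  forall U : set (F * F)%type, open U ->
    open ((fun p : F * F => ts_op p.1 p.2) @` U).

(* Main.v *)
From HB Require Import structures.
Require Import Defs.
From mathcomp Require Import all_boot.
From mathcomp Require Import boolp classical_sets filter topology.

(* Let F be a pro-V semigroup free over A; the image of A^+ in F is dense.
   If V is concatenation-closed and C, D are fibres of a continuous finite
   quotient of F, the words of C times the words of D form a V-recognizable
   language, so a neighbourhood of a product x y has all its words in C D; as
   C D is compact, the neighbourhood itself lies in C D.
   Conversely, if the multiplication is open then the product of the closures
   of two V-recognizable languages K and L is clopen, hence saturated for some
   continuous finite quotient. When V contains N and A is finite every word is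
   isolated in F, so the words in that product are exactly those of K L.
   That V contains N follows from concatenation-closure: recognizing the words
   of length at least 2 over one letter yields the two-element null semigroup,
   hence every letter, hence every word, is V-recognizable, and a nilpotent
   semigroup S is determined by finitely many words over S. *)

Set Implicit Arguments.
Unset Strict Implicit.
Unset Printing Implicit Defensive.

Local Open Scope classical_set_scope.

(** * Words and recognizable languages *)

Definition word_hom (A S : Type) (op : S -> S -> S) (phi : word A -> S) : Prop :=
  forall u v, phi (wcat u v) = op (phi u) (phi v).

Definition letter (A : Type) (a : A) : word A := (a, [::]).

Lemma word_ind (A : Type) (P : word A -> Prop) :
  (forall a, P (letter a)) -> (forall a w, P w -> P (wcat (letter a) w)) ->
  forall w, P w.
Proof.
move=> P1 PS [a s]; elim: s a => [|b s IHs] a; first exact: P1.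
exact: (PS a (b, s)).
Qed.

Definition weval (A S : Type) (op : S -> S -> S) (g : A -> S) (w : word A) : S :=
  foldl op (g w.1) (map g w.2).

Lemma foldl_op (S : Type) (op : S -> S -> S) : associative op ->
  forall x y s, foldl op (op x y) s = op x (foldl op y s).
Proof. by move=> opA x y s; elim: s y => [|z s IHs] y //=; rewrite -opA IHs. Qed.

Lemma weval_hom (A S : Type) (op : S -> S -> S) (g : A -> S) :
  associative op -> word_hom op (weval op g).
Proof.
by move=> opA [a s] [b t]; rewrite /weval /wcat /= map_cat foldl_cat /= foldl_op.
Qed.

Lemma word_hom_ext (A S : Type) (op : S -> S -> S) (phi psi : word A -> S) :
  word_hom op phi -> word_hom op psi ->
  (forall a, phi (letter a) = psi (letter a)) -> forall w, phi w = psi w.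
Proof.
move=> hphi hpsi e; elim/word_ind => [//|a w IHw].
by rewrite hphi hpsi e IHw.
Qed.

Section Subsemigroup.
Variables (S : finSemigroup) (P : pred S).
Hypothesis P_op : forall x y, P x -> P y -> P (fs_op x y).
Hypothesis P_ne : exists x, P x.

Definition sub_op (x y : {x | P x}) : {x | P x} :=
  exist P (fs_op (val x) (val y)) (P_op (valP x) (valP y)).

Lemma sub_opA : associative sub_op.
Proof. by move=> x y z; apply: val_inj; rewrite /= fs_assoc. Qed.

Lemma sub_nonempty : 0 < #|{: {x | P x}}|.
Proof. by have [x Px] := P_ne; apply/card_gt0P; exists (exist P x Px). Qed.

Definition sub_fs : finSemigroup := FinSemigroup sub_opA sub_nonempty.

Lemma sub_fs_in (V : finSemigroup -> Prop) : pseudovariety V -> V S -> V sub_fs.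
Proof.
by case=> Vsub _ _ _ VS; apply: (Vsub _ _ VS (val : sub_fs -> S)) => //; exact: val_inj.
Qed.

End Subsemigroup.

Section Pseudovariety.
Variable V : finSemigroup -> Prop.
Hypothesis pV : pseudovariety V.

Lemma word_hom_image (A : Type) (S : finSemigroup) (phi : word A -> S) :
  inhabited A -> V S -> word_hom (@fs_op S) phi ->
  exists (T : finSemigroup) (q : word A -> T),
    [/\ V T, word_hom (@fs_op T) q, (forall y, exists w, q w = y) &
        (forall u v, q u = q v <-> phi u = phi v)].
Proof.
move=> [a0] VS hphi.
pose P : pred S := fun x => `[< exists w, phi w = x >].
have Pop x y : P x -> P y -> P (fs_op x y).
  move=> /asboolP[u <-] /asboolP[v <-]; apply/asboolP.
  by exists (wcat u v); rewrite hphi.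
have Pphi w : P (phi w) by apply/asboolP; exists w.
have Pne : exists x, P x by exists (phi (letter a0)).
exists (sub_fs Pop Pne), (fun w => exist P (phi w) (Pphi w)); split.
- exact: sub_fs_in.
- by move=> u v; apply: val_inj; rewrite /= hphi.
- move=> [y Py]; have /asboolP[w e] := Py; exists w; exact: val_inj.
- by move=> u v; split=> [[]//|e]; apply: val_inj.
Qed.

(** [T] is a quotient of the image of [phi]. This is how the null semigroup and the nilpotent
    semigroups are shown to lie in [V]. *)
Lemma word_hom_divides (A : Type) (S T : finSemigroup)
    (phi : word A -> S) (psi : word A -> T) :
  V S -> word_hom (@fs_op S) phi -> word_hom (@fs_op T) psi ->
  (forall y, exists w, psi w = y) ->
  (forall u v, phi u = phi v -> psi u = psi v) -> V T.
Proof.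
move=> VS hphi hpsi spsi ker.
have Aex : inhabited A by have /card_gt0P[y _] := fs_nonempty T; have [[a _] _] := spsi y.
have [I [q [VI hq sq kq]]] := word_hom_image Aex VS hphi.
have [g gE] := choice sq.
have gK w : psi (g (q w)) = psi w by apply: ker; apply/kq; rewrite gE.
case: pV => _ Vquo _ _; apply: (Vquo _ _ VI (fun x => psi (g x))).
  move=> x y; rewrite -hpsi -{1}(gE x) -{1}(gE y) -hq.
  exact: gK.
by move=> y; have [w <-] := spsi y; exists (q w).
Qed.

Lemma recognizable_common (A : Type) (K L : word A -> Prop) :
  recognizable V K -> recognizable V L ->
  exists (F : finSemigroup) (phi : word A -> F),
    [/\ V F, word_hom (@fs_op F) phi,
        (forall u v, phi u = phi v -> K u -> K v) &
        (forall u v, phi u = phi v -> L u -> L v)].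
Proof.
move=> [F [phi [VF hphi phiK]]] [G [psi [VG hpsi psiL]]].
exists (prod_fs F G), (fun w => (phi w, psi w)); split.
- by case: pV => _ _ _; apply.
- by move=> u v; rewrite hphi hpsi.
- by move=> u v [e _] Ku; apply: phiK; exists u.
- by move=> u v [_ e] Lu; apply: psiL; exists u.
Qed.

Lemma recognizable_by (A : Type) (F : finSemigroup) (phi : word A -> F)
    (L : word A -> Prop) :
  V F -> word_hom (@fs_op F) phi -> (forall u v, phi u = phi v -> L u -> L v) ->
  recognizable V L.
Proof. by move=> VF hphi H; exists F, phi; split=> // w [u [Lu e]]; exact: H e Lu. Qed.

Lemma recognizableT (A : Type) : recognizable V (fun _ : word A => True).
Proof.
have opA : associative (fun _ _ : unit => tt) by [].
have ne : 0 < #|{: unit}| by rewrite card_unit.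
apply: (@recognizable_by A (FinSemigroup opA ne) (fun=> tt)) => //.
by case: pV => _ _ + _; apply; rewrite card_unit.
Qed.

(** * Reduction to finite alphabets *)

Definition wmap (A B : Type) (g : A -> B) (w : word A) : word B := (g w.1, map g w.2).

Lemma wmap_hom (A B : Type) (g : A -> B) u v :
  wmap g (wcat u v) = wcat (wmap g u) (wmap g v).
Proof. by rewrite /wmap /wcat /= map_cat. Qed.

(** A letter-to-letter substitution preserves length, so [w] is cut where its image is cut. *)
Lemma wmap_wcat_inv (A B : Type) (g : A -> B) w u v :
  wmap g w = wcat u v -> exists u' v', [/\ w = wcat u' v', wmap g u' = u & wmap g v' = v].
Proof.
case: w u v => [a s] [b t] [c r] [<-] e.
elim: t s e => [|x t IHt] [|y s] //= [e1 e2].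
  by exists (a, [::]), (y, s); rewrite /wmap /= e1 e2.
have [[a' p] [q [[<- es] [ep] eq]]] := IHt s e2.
by exists (a, y :: p), q; rewrite /wmap /wcat /= es e1 ep.
Qed.

(** The carrier of a common recognizing semigroup [F] serves as a finite alphabet: each letter of
    [A] is replaced by its value in [F], and [KL] is the preimage of a concatenation of languages
    over [F]. *)
Lemma concat_closed_allP : concat_closed V <-> concat_closed_all V.
Proof.
split=> [cc A K L Krec Lrec | cc A]; last exact: cc.
have [F [phi [VF hphi phiK phiL]]] := recognizable_common Krec Lrec.
pose p : A -> F := fun a => phi (letter a).
pose psi : word F -> F := weval (@fs_op F) id.
have hpsi : word_hom (@fs_op F) psi by apply: weval_hom; exact: fs_assoc.
have psiE w : psi (wmap p w) = phi w.
  apply: (word_hom_ext (phi := fun w => psi (wmap p w)) _ hphi) => //.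
  by move=> u v; rewrite wmap_hom hpsi.
pose lift (M : word A -> Prop) (w : word F) := exists2 u, M u & phi u = psi w.
have lift_rec M : recognizable V (lift M).
  by apply: (recognizable_by VF hpsi) => u v e [x Mx ex]; exists x; rewrite // ex.
have [G [theta [VG htheta thetaP]]] := cc _ _ _ (lift_rec K) (lift_rec L).
apply: (@recognizable_by A G (theta \o wmap p)) => //.
  by move=> u v; rewrite /= wmap_hom htheta.
move=> x y /= e [u [v [Ku Lv xE]]].
have : lcat (lift K) (lift L) (wmap p y).
  apply: thetaP; exists (wmap p x); split=> //.
  exists (wmap p u), (wmap p v); split; last by rewrite xE wmap_hom.
    by exists u; rewrite ?psiE.
  by exists v; rewrite ?psiE.
move=> [u' [v' [[u1 Ku1 e1] [v1 Lv1 e2] yE]]].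
have [y1 [y2 [-> ey1 ey2]]] := wmap_wcat_inv yE.
exists y1, y2; split=> //.
  by apply: phiK Ku1; rewrite e1 -ey1 psiE.
by apply: phiL Lv1; rewrite e2 -ey2 psiE.
Qed.

(** * Nilpotent members of a concatenation-closed pseudovariety *)

Definition null_op (_ _ : bool) : bool := false.

Lemma null_opA : associative null_op. Proof. by []. Qed.

Lemma null_nonempty : 0 < #|{: bool}|. Proof. by rewrite card_bool. Qed.

Definition null_fs : finSemigroup := FinSemigroup null_opA null_nonempty.

(** Over one letter, the full language times itself consists of the words of length at least 2. A
    homomorphism recognizing it separates the letter from all longer words, so its kernel refines
    that of the map sending only the letter to [true]. *)
Lemma null_fs_in : concat_closed V -> V null_fs.
Proof.
move=> cc; have [F [phi [VF hphi phiL]]] :=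
  cc _ _ _ (recognizableT unit) (recognizableT unit).
have aux u v : phi u = phi v -> nilp u.2 -> nilp v.2.
  move=> e; case: u e => a [|//] e _; case: v e => b [//|c s] e.
  have [|x [y [_ _ [_]]]] := phiL (a, [::]).
    by exists (b, c :: s); split=> //; exists (b, [::]), (c, s).
  by case: x.2.
apply: (word_hom_divides (psi := fun w : word unit => nilp w.2 : null_fs) VF hphi).
- by move=> [a s] [b t]; rewrite /wcat /nilp /= size_cat addnS.
- by case; [exists (tt, [::]) | exists (tt, [:: tt])].
- by move=> u v e; apply/idP/idP; apply: aux.
Qed.

(** A letter [a] is recognized by the null semigroup, with [a] sent to [true] and all other words to
    [false]; concatenation gives longer words. *)
Lemma recognizable1 (A : finType) (w : word A) :
  concat_closed V -> recognizable V (fun u => u = w).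
Proof.
move=> cc.
have rec1 (a : A) : recognizable V (fun u => u = letter a).
  apply: (recognizable_by (null_fs_in cc)
    (phi := fun u => nilp u.2 && (u.1 == a) : null_fs)).
    by move=> [b s] [c t]; rewrite /wcat /nilp /= size_cat addnS.
  by move=> u [b s] /= e ue; move: e; rewrite ue /= eqxx; case: s => //= /esym/eqP->.
elim/word_ind: w => [//|a w IHw].
suff -> : (fun u => u = wcat (letter a) w) =
    lcat (fun u => u = letter a) (fun u => u = w) by exact: cc.
apply/funext => u; apply/propext; split=> [->|[x [y [-> -> ->]]]//].
by exists (letter a), w.
Qed.

Lemma separating_hom (A : finType) (ws : seq (word A)) : concat_closed V ->
  exists (F : finSemigroup) (phi : word A -> F),
    [/\ V F, word_hom (@fs_op F) phi &
        forall w, w \in ws -> forall v, phi v = phi w -> v = w].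
Proof.
move=> cc; elim: ws => [|w ws [F [phi [VF hphi phiP]]]].
  by have [F [phi [VF hphi _]]] := recognizableT A; exists F, phi.
have [G [psi [VG hpsi psiP]]] := recognizable1 w cc.
exists (prod_fs F G), (fun u => (phi u, psi u)); split.
- by case: pV => _ _ _; apply.
- by move=> u v; rewrite hphi hpsi.
- move=> u; rewrite inE => /orP[/eqP-> | uws] v [e1 e2]; last exact: phiP e1.
  by apply: psiP; exists w.
Qed.

(** Words over [S] with more than [n] letters evaluate to zero, so a homomorphism isolating each of
    the finitely many other words has a kernel refining that of evaluation. *)
Lemma concat_closed_contains_N : concat_closed V -> contains_N V.
Proof.
move=> cc S [z [zP [n nilS]]].
pose psi : word S -> S := weval (@fs_op S) id.
have hpsi : word_hom (@fs_op S) psi by apply: weval_hom; exact: fs_assoc.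
have fz s : foldl (@fs_op S) z s = z by elim: s => //= x s IHs; rewrite (zP x).1.
have long w : n <= size w.2 -> psi w = z.
  move=> le_nw; rewrite /psi /weval map_id -(cat_take_drop n w.2) foldl_cat (nilS _ (take _ _)) ?fz //.
  by rewrite size_takel.
pose ws : seq (word S) := [seq (a, val s) | a <- enum S, s <- enum {: n.-bseq S}].
have [F [phi [VF hphi phiP]]] := separating_hom ws cc.
have wsP w : size w.2 <= n -> w \in ws.
  move=> le_wn; apply/allpairsP; exists (w.1, Bseq le_wn).
  by rewrite !mem_enum; split=> //; case: w le_wn.
apply: (word_hom_divides VF hphi hpsi) => [y|u v e].
  by exists (letter y).
have [/wsP/phiP uP | /ltnW/long eu] := leqP (size u.2) n; first by rewrite (uP v).
have [/wsP/phiP vP | /ltnW/long ev] := leqP (size v.2) n; first by rewrite -(vP u).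
by rewrite eu ev.
Qed.

End Pseudovariety.

(** * Pro-V semigroups as limit cones *)

Lemma forall_choice (I : Type) (T : I -> Type) (P : forall i, T i -> Prop) :
  (forall i, exists y, P i y) -> exists t : forall i, T i, forall i, P i (t i).
Proof. by move=> H; exists (fun i => sval (cid (H i))) => i; exact: svalP. Qed.

(** The algebraic half of [proV]. The topology is recovered below from the projections, so that a
    pro-V semigroup can be built from a bare limit cone. *)
Record cone (V : finSemigroup -> Prop) (S : Type) (op : S -> S -> S) := Cone {
  cidx : Type;
  cle : cidx -> cidx -> Prop;
  cfs : cidx -> finSemigroup;
  cmap : forall i j, cle i j -> cfs j -> cfs i;
  cpi : forall i, S -> cfs i;
  c_order : [/\ inhabited cidx, (forall i, cle i i),
    (forall i j k, cle i j -> cle j k -> cle i k) &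
    (forall i j, exists k, cle i k /\ cle j k)];
  c_system : [/\ (forall i, V (cfs i)),
    (forall i j (h : cle i j), fs_hom (cmap h)),
    (forall i (h : cle i i) x, cmap h x = x) &
    (forall i j k (hij : cle i j) (hjk : cle j k) (hik : cle i k) x,
      cmap hij (cmap hjk x) = cmap hik x)];
  c_hom : forall i x y, cpi i (op x y) = fs_op (cpi i x) (cpi i y);
  c_compat : forall i j (h : cle i j) x, cmap h (cpi j x) = cpi i x;
  c_inj : forall x y : S, (forall i, cpi i x = cpi i y) -> x = y;
  c_thread : forall t : forall i, cfs i,
    (forall i j (h : cle i j), cmap h (t j) = t i) ->
    exists x : S, forall i, cpi i x = t i }.

Arguments cfs {V S op} c i.
Arguments cpi {V S op} c i x.
Arguments c_thread {V S op} c t.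

Lemma cpi_le V S op (c : @cone V S op) i j x y :
  cle i j -> cpi c j x = cpi c j y -> cpi c i x = cpi c i y.
Proof. by move=> h e; rewrite -!(c_compat h) e. Qed.

Section ConeSpace.
Variables (V : finSemigroup -> Prop) (S : Type) (op : S -> S -> S).
Hypothesis opA : associative op.
Variable c : cone V op.

(** The initial topology of the projections; as the indices are directed, their fibres form a
    base. *)
Definition cone_open (U : set S) : Prop :=
  forall x, U x -> exists i, cpi c i @^-1` [set cpi c i x] `<=` U.

Lemma cone_openT : cone_open setT.
Proof. by move=> x _; have [[i] _ _ _] := c_order c; exists i. Qed.

Lemma cone_openI : setI_closed cone_open.
Proof.
move=> U W oU oW x [/oU[i sU] /oW[j sW]].
have [_ _ _ /(_ i j)[k [ik jk]]] := c_order c.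
by exists k => y /= e; split; [apply: sU; apply: cpi_le e | apply: sW; apply: cpi_le e].
Qed.

Lemma cone_open_bigU (I : Type) (U : I -> set S) :
  (forall i, cone_open (U i)) -> cone_open (\bigcup_i U i).
Proof. by move=> oU x [i _ /oU[k sU]]; exists k => y /sU Uy; exists i. Qed.

(** A copy of [S] that mentions the cone, so that the topology attached to it can depend on [c]. *)
Definition cone_car (_ : cone V op) : Type := S.
HB.instance Definition _ := gen_eqMixin (cone_car c).
HB.instance Definition _ := gen_choiceMixin (cone_car c).
HB.instance Definition _ :=
  isOpenTopological.Build (cone_car c) cone_openT cone_openI cone_open_bigU.

Lemma cone_openE : (open : set_system (cone_car c)) = cone_open.
Proof. by []. Qed.

Lemma cone_nbhsP (x : cone_car c) (U : set S) :
  nbhs x U <-> exists i, cpi c i @^-1` [set cpi c i x] `<=` U.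
Proof.
rewrite nbhsE; split=> [[W [oW Wx] WU]|[i iU]].
  by have [i iW] := oW x Wx; exists i; apply: subset_trans WU.
exists (cpi c i @^-1` [set cpi c i x]) => //; split=> //.
by rewrite cone_openE => y /= e; exists i => z /=; rewrite e.
Qed.

Lemma cone_cont : continuous (fun p : cone_car c * cone_car c => op p.1 p.2 : cone_car c).
Proof.
move=> [x y] U /cone_nbhsP[i iU].
exists (cpi c i @^-1` [set cpi c i x], cpi c i @^-1` [set cpi c i y]).
  by split; apply/cone_nbhsP; exists i.
by move=> [x' y'] [/= ex ey]; apply: iU; rewrite /= !c_hom ex ey.
Qed.

Definition cone_ts : topSemigroup := @TopSemigroup (cone_car c) op opA cone_cont.

Lemma cone_ts_fiber (x : cone_ts) i : \forall y \near x, cpi c i y = cpi c i x.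
Proof. by apply/cone_nbhsP; exists i. Qed.

(** An ultrafilter contains one of the finitely many fibres of each projection. Any two of the
    selected fibres meet, so their values form a thread, and the ultrafilter converges to its
    limit. *)
Lemma cone_compact : compact [set: cone_car c].
Proof.
rewrite compact_ultra => U UU _.
have fib i : exists y, U (cpi c i @^-1` [set y]).
  apply: contrapT => /forallNP nU.
  have : \forall x \near U, forall y, cpi c i x <> y.
    apply: filter_forall => y.
    by have [/nU//|] := in_ultra_setVsetC (cpi c i @^-1` [set y]) UU.
  by move=> /filter_ex[x /(_ (cpi c i x))].
have [t tU] := forall_choice fib.
have [|x xt] := c_thread c t.
  move=> i j h.
  have /filter_ex[x [/= <- <-]] :
    U (cpi c i @^-1` [set t i] `&` cpi c j @^-1` [set t j]) by exact: filterI.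
  exact: c_compat.
exists x; split=> // W /cone_nbhsP[i iW]; apply: filterS (tU i).
by rewrite -xt.
Qed.

Lemma cone_proV : proV V cone_ts.
Proof.
split; first exact: cone_compact.
exists (cidx c), (@cle _ _ _ c), (cfs c), (@cmap _ _ _ c), (cpi c).
split; [exact: c_order | exact: c_system | | |].
- split; [exact: c_hom | | exact: c_compat].
  by move=> i y; rewrite cone_openE => x /= e; exists i => z /=; rewrite e.
- split; [exact: c_inj | exact: c_thread].
- by [].
Qed.

End ConeSpace.

Lemma proV_cone V (S : topSemigroup) : proV V S -> exists c : cone V (@ts_op S),
  [/\ compact [set: S], (forall i y, open (cpi c i @^-1` [set y])) &
      forall U : set S, open U -> cone_open c U].
Proof.
move=> [cS [I [le [F [f [pi [ho hs [h1 h2 h3] [h4 h5] h6]]]]]]].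
by exists (Cone ho hs h1 h3 h4 h5).
Qed.

Section ProV.
Variables (V : finSemigroup -> Prop) (S : topSemigroup) (c : cone V (@ts_op S)).
Hypothesis cS : compact [set: S].
Hypothesis open_fiber : forall i y, open (cpi c i @^-1` [set y]).
Hypothesis open_base : forall U : set S, open U -> cone_open c U.

Lemma fiber_nbhs i (x : S) : \forall y \near x, cpi c i y = cpi c i x.
Proof. exact: (open_nbhs_nbhs (conj (open_fiber (cpi c i x)) erefl)). Qed.

Lemma nbhs_fiber (x : S) (U : set S) :
  nbhs x U -> exists i, cpi c i @^-1` [set cpi c i x] `<=` U.
Proof.
rewrite nbhsE => -[W [oW Wx] WU]; have [i iW] := open_base oW Wx.
by exists i; apply: subset_trans WU.
Qed.

Lemma cone_continuous (X : topologicalType) (h : X -> S) :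
  (forall i x, \forall y \near x, cpi c i (h y) = cpi c i (h x)) -> continuous h.
Proof.
move=> H x U /nbhs_fiber[i iU]; apply: filterS (H i x) => y e; exact: iU.
Qed.

Lemma cone_hausdorff : hausdorff_space S.
Proof.
move=> x y cl; apply: (c_inj (c := c)) => i.
by have [z [/= <- <-]] := cl _ _ (fiber_nbhs i x) (fiber_nbhs i y).
Qed.

(** The product is a continuous image of a compact set in a Hausdorff space. *)
Lemma closed_mul (C D : set S) : closed C -> closed D ->
  closed [set ts_op x y | x in C & y in D].
Proof.
move=> clC clD; apply: (compact_closed cone_hausdorff).
have -> : [set ts_op x y | x in C & y in D] =
    (fun p : S * S => ts_op p.1 p.2) @` (C `*` D).
  rewrite predeqE => z; split=> [[x Cx [y Dy <-]]|[[x y] [/= Cx Dy] <-]].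
    by exists (x, y).
  by exists x => //; exists y.
apply: continuous_compact; first by apply: continuous_subspaceT; exact: ts_cont.
by apply: compact_setX; apply: subclosed_compact cS _.
Qed.

(** Around each point some fibre lies inside [C] or inside its complement; compactness, used along
    the filter of tails of the directed index set, gives one index for all points. *)
Lemma clopen_saturated (C : set S) : open C -> closed C ->
  exists i, forall x y, cpi c i x = cpi c i y -> C x -> C y.
Proof.
move=> oC /closed_openC oC'.
have [[i0] le_refl le_trans dir] := c_order c.
pose F := filter_from [set: cidx c] (fun i => [set k | cle i k]).
have FF : ProperFilter F.
  apply: filter_from_proper; last by move=> i _; exists i; exact: le_refl.
  apply: filter_from_filter; first by exists i0.
  move=> i j _ _; have [k [ik jk]] := dir i j; exists k => // l /= kl.
  by split; apply: le_trans kl.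
pose P k x := forall y, cpi c k x = cpi c k y -> C x -> C y.
have [i _ iP] : \near F, [set: S] `<=` P F.
  move/compact_near_coveringP : cS; apply=> x _.
  have [i sat] : exists i, forall y, cpi c i y = cpi c i x -> C y <-> C x.
    have [Cx|nCx] := pselect (C x).
      by have [i iC] := open_base oC Cx; exists i => y /iC.
    by have [i iC] := open_base oC' nCx; exists i => y /iC.
  exists (cpi c i @^-1` [set cpi c i x], [set k | cle i k]).
    by split; [exact: fiber_nbhs | exists i].
  move=> [x' k] [/= ex ik] y e.
  have ey : cpi c i y = cpi c i x by rewrite -ex; apply: esym; apply: cpi_le e.
  by move/(sat x' ex)/(sat y ey).
exists i => x y; apply: (iP i) => //; exact: le_refl.
Qed.

End ProV.

Section FiniteCone.
Variables (V : finSemigroup -> Prop) (G : finSemigroup) (VG : V G).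

(** A one-index constant system: the fibres are singletons, so the topology is discrete. *)
Definition fin_cone : cone V (@fs_op G).
Proof.
refine (@Cone V G (@fs_op G) unit (fun _ _ => True) (fun=> G) (fun _ _ _ x => x)
  (fun _ x => x) _ _ _ _ _ _).
- by split=> // _ _; exists tt.
- by [].
- by [].
- by [].
- by move=> x y H; exact: (H tt).
- by move=> t te; exists (t tt) => -[].
Defined.

Definition fin_ts : topSemigroup := cone_ts (@fs_assoc G) fin_cone.

Lemma fin_ts_proV : proV V fin_ts. Proof. exact: cone_proV. Qed.

Lemma fin_ts_nbhs (x : fin_ts) : nbhs x [set x].
Proof. by apply/cone_nbhsP; exists tt. Qed.

Lemma fin_ts_cont (X : topologicalType) (h : X -> fin_ts) :
  continuous h <-> (forall x, \forall y \near x, h y = h x).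
Proof.
split=> [ch x|H x U Ux]; first exact: ch (fin_ts_nbhs (h x)).
by apply: filterS (H x) => y /= ->; exact: nbhs_singleton.
Qed.

End FiniteCone.

(** * Openness of the multiplication in free pro-V semigroups *)

(** The powers of an element are eventually periodic by pigeonhole. Idempotents give the constant
    homomorphisms used for the empty alphabet. *)
Lemma finSemigroup_idempotent (S : finSemigroup) : exists e : S, fs_op e e = e.
Proof.
have /card_gt0P[x _] := fs_nonempty S.
(* p n is the power x^(n+1) *)
pose p n := iter n (fs_op x) x.
have pD m n : fs_op (p m) (p n) = p (m + n).+1.
  by elim: m => [|m IHm] //=; rewrite -fs_assoc IHm.
have [i [j [lt_ij pij]]] : exists i j, i < j /\ p i = p j.
  apply: contrapT => H.
  have pinj : injective (fun k : 'I_#|S|.+1 => p k).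
    move=> k l /= e; apply: val_inj => /=.
    case: (ltngtP k l) => // lt_kl; case: H; first by exists k, l.
    by exists l, k; rewrite e.
  by have := leq_card _ pinj; rewrite card_ord ltnn.
pose d := j - i.
have per n : i <= n -> p n = p (n + d).
  move=> le_in; rewrite -(subnK le_in) -addnA [i + d]subnKC; last exact: ltnW.
  by elim: (n - i) => //= m ->.
have pers k n : i <= n -> p n = p (n + k * d).
  move=> le_in; elim: k => [|k IHk]; first by rewrite addn0.
  rewrite mulSn addnCA addnC -per //; exact: leq_trans (leq_addr _ _).
have d0 : 0 < d by rewrite subn_gt0.
(* the exponent (i+1)d is a multiple of the period lying beyond the preperiod *)
pose n := (i.+1 * d).-1.
have n1 : n.+1 = i.+1 * d by rewrite prednK // muln_gt0.
have le_in : i <= n by rewrite -ltnS n1 leq_pmulr.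
by exists (p n); rewrite pD -addnS n1 -pers.
Qed.

Section SubCone.
Variables (V : finSemigroup -> Prop) (pV : pseudovariety V).
Variables (S : Type) (op : S -> S -> S) (opA : associative op) (c : cone V op).
Variable P : forall i, cfs c i -> bool.
Arguments P : clear implicits.
Hypothesis P_op : forall i x y, P i x -> P i y -> P i (fs_op x y).
Hypothesis P_map : forall i j (h : cle i j) y, P j y -> P i (cmap h y).
Hypothesis P_ne : forall i, exists y, P i y.

(** The limit of the restricted system of the [P i]; below, [P i] will consist of the values of
    words. *)
Definition sub_car := {x : S | forall i, P i (cpi c i x)}.

Lemma sub_car_inj (x y : sub_car) : sval x = sval y -> x = y.
Proof. by case: x y => [x px] [y py] /= e; subst y; congr exist; exact: Prop_irrelevance. Qed.

Lemma sub_car_op_subproof (x y : sub_car) i : P i (cpi c i (op (sval x) (sval y))).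
Proof. by rewrite c_hom; apply: P_op; [exact: (svalP x) | exact: (svalP y)]. Qed.

Definition sub_car_op (x y : sub_car) : sub_car := exist _ _ (sub_car_op_subproof x y).

Lemma sub_car_opA : associative sub_car_op.
Proof. by move=> x y z; apply: sub_car_inj; exact: opA. Qed.

Definition sub_cone : cone V sub_car_op.
Proof.
refine (@Cone V sub_car sub_car_op (cidx c) (@cle _ _ _ c)
  (fun i => sub_fs (@P_op i) (P_ne i))
  (fun i j h y => exist _ (cmap h (sval y)) (P_map h (svalP y)))
  (fun i x => exist _ (cpi c i (sval x)) (svalP x i)) _ _ _ _ _ _).
- exact: c_order.
- have [h1 h2 h3 h4] := c_system c; split.
  + by move=> i; exact: sub_fs_in.
  + by move=> i j h x y; apply: val_inj; exact: h2.
  + by move=> i h x; apply: val_inj; exact: h3.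
  + by move=> i j k hij hjk hik x; apply: val_inj; exact: h4.
- by move=> i x y; apply: val_inj; exact: c_hom.
- by move=> i j h x; apply: val_inj; exact: c_compat.
- move=> x y H; apply: sub_car_inj; apply: (c_inj (c := c)) => i.
  by have /(congr1 val) := H i.
- move=> t te.
  have [i j h|x xt] := c_thread c (fun i => sval (t i)).
    by have /(congr1 val) := te i j h.
  have xP i : P i (cpi c i x) by rewrite xt; exact: valP.
  by exists (exist _ x xP) => i; apply: val_inj; exact: xt.
Defined.

Definition sub_ts : topSemigroup := cone_ts sub_car_opA sub_cone.

Lemma sub_ts_fiber (x : sub_ts) i : \forall y \near x, cpi c i (sval y) = cpi c i (sval x).
Proof.
have := @cone_ts_fiber _ _ _ sub_car_opA sub_cone x i.
by apply: filterS => y /= /(congr1 val).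
Qed.

End SubCone.

Section Free.
Variables (V : finSemigroup -> Prop) (pV : pseudovariety V).
Variables (A : Type) (F : topSemigroup) (iota : A -> F).
Hypothesis freeF : free_proV V iota.
Variable c : cone V (@ts_op F).
Hypothesis cF : compact [set: F].
Hypothesis open_fiber : forall i y, open (cpi c i @^-1` [set y]).
Hypothesis open_base : forall U : set F, open U -> cone_open c U.

Let ev := weval (@ts_op F) iota.

Let ev_hom : word_hom (@ts_op F) ev.
Proof. by apply: weval_hom; exact: ts_assoc. Qed.

(** Freeness applied to [G] with the discrete topology. Languages recognized by [phi] thus become
    traces on words of clopen sets, the unions of fibres of [Phi]. *)
Lemma free_extension (G : finSemigroup) (phi : word A -> G) :
  V G -> word_hom (@fs_op G) phi ->
  exists Phi : F -> G, [/\ (forall x y, Phi (ts_op x y) = fs_op (Phi x) (Phi y)),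
    (forall x, \forall y \near x, Phi y = Phi x) & (forall w, Phi (ev w) = phi w)].
Proof.
move=> VG hphi.
have [h [[hc hh ha] _]] := freeF.2 _ (fin_ts_proV VG) (fun a => phi (letter a)).
exists h; split=> //; first exact/fin_ts_cont.
apply: (word_hom_ext (phi := fun w => h (ev w)) _ hphi) => //.
by move=> u v; rewrite ev_hom hh.
Qed.

Let inW i (y : cfs c i) : bool := `[< exists w, y = cpi c i (ev w) >].

Let inW_op i (x y : cfs c i) : inW x -> inW y -> inW (fs_op x y).
Proof.
move=> /asboolP[u ->] /asboolP[v ->]; apply/asboolP; exists (wcat u v).
by rewrite ev_hom c_hom.
Qed.

Let inW_map i j (h : cle i j) (y : cfs c j) : inW y -> inW (cmap h y).
Proof. by move=> /asboolP[w ->]; apply/asboolP; exists w; rewrite c_compat. Qed.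

(* The threads all of whose components are values of words form a pro-V
   semigroup T through which iota factors; freeness makes F a retract of it. *)
Lemma free_dense (x : F) i : inhabited A -> exists w, cpi c i x = cpi c i (ev w).
Proof.
move=> [a0].
have inW_ne j : exists y : cfs c j, inW y.
  by exists (cpi c j (ev (letter a0))); apply/asboolP; exists (letter a0).
have gP a j : inW (cpi c j (iota a)) by apply/asboolP; exists (letter a).
pose T := sub_ts pV (@ts_assoc F) inW_op inW_map inW_ne.
pose g a : T := exist _ (iota a) (gP a).
have [h [[hc hh ha] _]] := freeF.2 T (cone_proV _ _) g.
have [k [_ kuniq]] := freeF.2 F freeF.1 iota.
have e1 : k = id.
  by apply: kuniq; split=> // y; exact: cvg_id.
have e2 : k = (fun y => sval (h y)).
  apply: kuniq; split.
  - apply: (cone_continuous open_base) => j y.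
    exact: hc (sub_ts_fiber (h y) j).
  - by move=> y z; rewrite hh.
  - by move=> a; rewrite ha.
have -> : x = sval (h x) by rewrite -[RHS]/((fun y => sval (h y)) x) -e2 e1.
by have /asboolP := svalP (h x) i.
Qed.

Lemma free_open_mult : concat_closed_all V -> inhabited A -> open_mult F.
Proof.
move=> cc Aex U oU; rewrite openE => _ [[x0 y0] Uxy <-] /=.
have [[X Y] [/= nX nY] XYU] := open_nbhs_nbhs (conj oU Uxy).
have [i iX] := nbhs_fiber open_base nX; have [j jY] := nbhs_fiber open_base nY.
have [_ _ _ /(_ i j)[k [ik jk]]] := c_order c.
pose C := cpi c k @^-1` [set cpi c k x0]; pose D := cpi c k @^-1` [set cpi c k y0].
have clfib y : closed (cpi c k @^-1` [set y]).
  rewrite -openC openE => x /= nx; apply: filterS (fiber_nbhs open_fiber k x).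
  by move=> x' /= ->.
pose CD := [set ts_op x y | x in C & y in D].
have clCD : closed CD by apply: (closed_mul cF open_fiber); exact: clfib.
have sCD : CD `<=` (fun p : F * F => ts_op p.1 p.2) @` U.
  move=> z [x /= Cx [y /= Dy <-]]; exists (x, y) => //; apply: XYU; split => /=.
    by apply: iX; apply: cpi_le Cx.
  by apply: jY; apply: cpi_le Dy.
have Vk : V (cfs c k) by have [+ _ _ _] := c_system c; apply.
have kev : word_hom (@fs_op _) (cpi c k \o ev).
  by move=> u v; rewrite /= ev_hom c_hom.
have recC (x : F) : recognizable V (fun w => cpi c k (ev w) = cpi c k x).
  by apply: (recognizable_by Vk kev) => u v /= ->.
have [G [psi [VG hpsi psiP]]] := cc _ _ _ (recC x0) (recC y0).
have [Psi [hPsi cPsi PsiE]] := free_extension VG hpsi.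
(* words are dense, so this neighbourhood of the product x0 y0 lies in the
   closure of the words of the concatenation, hence in the closed set CD *)
have near_word x : exists w, [/\ Psi (ev w) = Psi x & cpi c k (ev w) = cpi c k x].
  have [l lP] := nbhs_fiber open_base (filterI (cPsi x) (fiber_nbhs open_fiber k x)).
  by have [w e] := free_dense x l Aex; exists w; apply: lP; rewrite /= e.
apply: filterS (cPsi (ts_op x0 y0)) => z /= ez; apply: sCD.
apply: clCD => W nW.
have [l lP] := nbhs_fiber open_base (filterI nW (cPsi z)).
have [w e] := free_dense z l Aex.
have [Ww ePsi] : W (ev w) /\ Psi (ev w) = Psi z by apply: lP; rewrite /= e.
have [u [eu ku]] := near_word x0; have [v [ev' kv]] := near_word y0.
(* [w] has the same image under [psi] as the product of [u] and [v], which lies in the recognizable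
   concatenation. *)
have [u1 [v1 [ku1 kv1 wE]]] : lcat (fun w => cpi c k (ev w) = cpi c k x0)
    (fun w => cpi c k (ev w) = cpi c k y0) w.
  apply: psiP; exists (wcat u v); split; first by exists u, v.
  by rewrite -!PsiE ePsi ez ev_hom !hPsi eu ev'.
exists (ev w); split=> //; exists (ev u1) => //; exists (ev v1) => //.
by rewrite wE ev_hom.
Qed.

(** Without letters, freeness leaves a single continuous homomorphism from [F] to each member of
    [V]. A constant map to an idempotent is one, so every projection is constant and [F] has at most
    one point. *)
Lemma free_open_mult_empty : (A -> False) -> open_mult F.
Proof.
move=> A0.
have Fsub (x y : F) : x = y.
  apply: (c_inj (c := c)) => i.
  have Vi : V (cfs c i) by have [+ _ _ _] := c_system c; apply.
  have [e ee] := finSemigroup_idempotent (cfs c i).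
  have [h [_ hu]] := freeF.2 _ (fin_ts_proV Vi) (fun a => False_rect _ (A0 a)).
  have h1 : h = cpi c i.
    apply: hu; split; first by apply/fin_ts_cont => z; exact: fiber_nbhs.
      by move=> a b; exact: c_hom.
    by move=> a; case: (A0 a).
  have h2 : h = (fun=> e).
    apply: hu; split; first by apply/fin_ts_cont => z; exact: nearW.
      by move=> a b; rewrite /= ee.
    by move=> a; case: (A0 a).
  by rewrite -h1 h2.
move=> U oU; rewrite openE => z [p Up _].
by apply: filterS filterT => y _; exists p.
Qed.

End Free.

(** * Isolation of words, and existence of free pro-V semigroups *)

Section BoundedWords.
Variables (A : finType) (n : nat).

(* Nonempty sequences of length at most n; the empty one plays the role of zero. *)
Definition bword_op (x y : n.-bseq A) : n.-bseq A :=
  if nilp x || nilp y then [bseq] else insub_bseq n (x ++ y).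

Lemma val_insub_bseq (s : seq A) :
  insub_bseq n s = (if size s <= n then s else [::]) :> seq A.
Proof. by rewrite val_insubd. Qed.

Lemma val_bword_op (x y : n.-bseq A) : bword_op x y =
  (if [|| nilp x, nilp y | n < size x + size y] then [::] else x ++ y) :> seq A.
Proof.
rewrite /bword_op orbA; case: (nilp x || nilp y) => //=.
by rewrite val_insub_bseq size_cat leqNgt; case: ltnP.
Qed.

Lemma bword_opA : associative bword_op.
Proof.
move=> x y z; apply: val_inj; rewrite /= !val_bword_op.
case: (boolP (nilp x)) => [//|x0]; case: (boolP (nilp y)) => [//|y0] /=.
case: (boolP (nilp z)) => [z0|z0] /=; first by rewrite orbT.
have cat0 (s t : seq A) : ~~ nilp s -> ~~ nilp (s ++ t).
  by rewrite /nilp size_cat addn_eq0 negb_and => ->.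
have [yz|yz] := ltnP n (size y + size z); have [xy|xy] := ltnP n (size x + size y) => //=.
- by rewrite (negbTE (cat0 _ _ x0)) /= size_cat -addnA (leq_trans yz) // leq_addl.
- by rewrite (negbTE (cat0 _ _ y0)) /= size_cat addnA (leq_trans xy) // leq_addr.
- rewrite (negbTE (cat0 _ _ y0)) (negbTE (cat0 _ _ x0)) /= !size_cat addnA.
  by rewrite catA.
Qed.

Lemma bword_nonempty : 0 < #|{: n.-bseq A}|.
Proof. by apply/card_gt0P; exists [bseq]. Qed.

Definition bword_fs : finSemigroup := FinSemigroup bword_opA bword_nonempty.

Lemma bword_op0 (x : n.-bseq A) : bword_op [bseq] x = [bseq] /\ bword_op x [bseq] = [bseq].
Proof. by split; apply: val_inj; rewrite [LHS]val_bword_op //= orbT. Qed.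

Lemma bword_nilpotent : nilpotent bword_fs.
Proof.
exists [bseq]; split; first exact: bword_op0.
exists n => x s sn; apply: val_inj; apply/nilP.
(* Each nonempty factor adds a letter, so a nonzero product of [x] with [n] further factors has
   length at least [n + size x]. The bound [n] forces [x] to be empty, and then the product is
   zero. *)
have H : nilp (foldl bword_op x s) || (size s + size x <= size (foldl bword_op x s)).
  elim: s x {sn} => [|y s IHs] x /=; first by rewrite leqnn orbT.
  have /orP[->//|le] := IHs (bword_op x y).
  case: (boolP (nilp (foldl bword_op _ s))) => //= nz.
  have : ~~ nilp (bword_op x y).
    apply: contra nz => /nilP e.
    have -> : bword_op x y = [bseq] by exact: val_inj.
    by elim: s {IHs le} => //= z s IHs; rewrite (bword_op0 z).1.
  move: le; rewrite val_bword_op; case: ifP => //.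
  move/negbT; rewrite !negb_or => /and3P[x0 y0 _] + _.
  rewrite size_cat; apply: leq_trans; rewrite addSn -addnS leq_add2l.
  by rewrite -addn1 leq_add2l lt0n.
case/orP: H => // le; have := leq_trans le (size_bseq _); rewrite sn.
rewrite -[X in _ <= X]addn0 leq_add2l leqn0 => /eqP x0.
have -> : x = [bseq] by apply: val_inj; exact: size0nil.
by elim: s {sn le} => //= z s IHs; rewrite (bword_op0 z).1.
Qed.

(** Words with more than [n] letters get the default value of [insub_bseq], the empty sequence,
    which is the zero. *)
Definition bword_of (w : word A) : bword_fs := insub_bseq n (w.1 :: w.2).

Lemma bword_of_hom : word_hom (@fs_op bword_fs) bword_of.
Proof.
move=> [a s] [b t]; apply: val_inj; rewrite /= val_bword_op !val_insub_bseq /=.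
rewrite size_cat /=.
case: (ltnP (size s) n) => sn; last first.
  by rewrite ltnNge (leq_trans sn) ?leq_addr.
case: (ltnP (size t) n) => tn /=.
  by rewrite addSn addnS [in RHS]ltnNge; case: leqP.
by rewrite ltnNge (leq_trans tn) // addnS leqW // leq_addl.
Qed.

Lemma bword_of_inj (u v : word A) : size v.2 < n -> bword_of u = bword_of v -> u = v.
Proof.
move=> vn /(congr1 val); rewrite /= !val_insub_bseq /= vn.
by case: ifP => // _; case: u v {vn} => [a s] [b t] [-> ->].
Qed.

End BoundedWords.

Lemma open_setX (X Y : topologicalType) (U : set X) (W : set Y) :
  open U -> open W -> open (U `*` W).
Proof.
move=> oU oW; rewrite openE => -[x y] [/= Ux Wy].
by exists (U, W) => //; split; exact: open_nbhs_nbhs.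
Qed.

(** * Recognizable concatenations from an open multiplication *)

Section FromOpenMult.
Variables (V : finSemigroup -> Prop) (pV : pseudovariety V).
Variables (A : finType) (F : topSemigroup) (iota : A -> F).
Hypotheses (freeF : free_proV V iota) (VN : contains_N V) (openF : open_mult F).
Variable a0 : A.
Variable c : cone V (@ts_op F).
Hypothesis cF : compact [set: F].
Hypothesis open_fiber : forall i y, open (cpi c i @^-1` [set y]).
Hypothesis open_base : forall U : set F, open U -> cone_open c U.

Let ev := weval (@ts_op F) iota.

Lemma open_mult_lcat (K L : word A -> Prop) :
  recognizable V K -> recognizable V L -> recognizable V (lcat K L).
Proof.
move=> Krec Lrec.
have ev_hom : word_hom (@ts_op F) ev by apply: weval_hom; exact: ts_assoc.
have [G [phi [VG hphi phiK phiL]]] := recognizable_common pV Krec Lrec.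
have [Phi [hPhi cPhi PhiE]] := free_extension freeF VG hphi.
(* A union of fibres of [Phi], hence clopen. For [K] and [L] it is the closure of the words of the
   language. *)
pose bar (M : word A -> Prop) : set F := [set x | exists2 u, M u & phi u = Phi x].
have open_bar (P : G -> Prop) : open [set x | P (Phi x)].
  rewrite openE => x /= Px; apply: filterS (cPhi x) => y /= ->; exact: Px.
have oK M : open (bar M) by apply: (open_bar (fun g => exists2 u, M u & phi u = g)).
have cK M : closed (bar M).
  rewrite -openC; exact: (open_bar (fun g => ~ exists2 u, M u & phi u = g)).
pose KL := [set ts_op x y | x in bar K & y in bar L].
have clKL : closed KL by exact: (closed_mul cF open_fiber).
have opKL : open KL.
  have := openF (open_setX (oK K) (oK L)); congr open.
  rewrite predeqE => z; split=> [[[x y] [/= Kx Ly] <-]|[x Kx [y Ly <-]]].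
    by exists x => //; exists y.
  by exists (x, y).
have [i sat] := clopen_saturated cF open_fiber open_base opKL clKL.
have Vi : V (cfs c i) by have [+ _ _ _] := c_system c; apply.
have iev : word_hom (@fs_op _) (cpi c i \o ev) by move=> u v; rewrite /= ev_hom c_hom.
apply: (recognizable_by Vi iev) => u v /= /sat satuv [a [b [Ka Lb uE]]].
have : KL (ev v).
  apply: satuv; rewrite uE ev_hom.
  by exists (ev a); [exists a | exists (ev b); first exists b; rewrite ?PhiE].
move=> [x [a1 Ka1 ea1] [y [b1 Lb1 eb1] xy]].
(* words are isolated: a nilpotent quotient separates v from all other words *)
pose n := (size v.2).+1.
have hnu : word_hom (@fs_op (bword_fs A n)) (@bword_of A n) by exact: bword_of_hom.
have [Nu [hNu cNu NuE]] := free_extension freeF (VN (@bword_nilpotent A n)) hnu.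
have {}NuE w : Nu (ev w) = bword_of n w by exact: NuE.
have near_word z : exists w, Nu (ev w) = Nu z /\ phi w = Phi z.
  have [l lP] := nbhs_fiber open_base (filterI (cNu z) (cPhi z)).
  have [w e] := free_dense pV freeF open_base z l (inhabits a0).
  by exists w; rewrite -PhiE; apply: lP; rewrite /= e.
(* The factors [x] and [y] of [ev v] are replaced by words with the same images under [Nu] and
   [Phi]; the product of these words has the [Nu]-image of [v], hence is [v]. *)
have [a' [ea pa]] := near_word x; have [b' [eb pb]] := near_word y.
exists a', b'; split.
- by apply: phiK Ka1; rewrite ea1.
- by apply: phiL Lb1; rewrite eb1.
- apply/esym/(@bword_of_inj A n) => //.
  by rewrite -!NuE -xy ev_hom !hNu ea eb.
Qed.

End FromOpenMult.

(** * The free pro-V semigroup as a limit of finite quotients *)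

Section FreeConstruction.
Variables (V : finSemigroup -> Prop) (pV : pseudovariety V) (A : Type) (a0 : A).

Definition word_quotient (S : finSemigroup) (phi : word A -> S) : Prop :=
  [/\ V S, word_hom (@fs_op S) phi & forall y, exists w, phi w = y].

(* Indexing by the kernels rather than by the quotients keeps the index type
   in the universe of the words. *)
Definition congruence : Type := {R : word A -> word A -> Prop |
  exists S, exists2 phi : word A -> fs_car S, word_quotient phi &
    forall u v, phi u = phi v <-> R u v}.

Implicit Types i j k : congruence.

Definition quo i : finSemigroup := sval (cid (svalP i)).

Lemma quo_subproof i : exists phi : word A -> quo i,
  word_quotient phi /\ forall u v, phi u = phi v <-> sval i u v.
Proof. by have [phi] := svalP (cid (svalP i)); exists phi. Qed.

Definition quo_map i : word A -> quo i := sval (cid (quo_subproof i)).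

Lemma quo_in i : V (quo i).
Proof. by have [[]] := svalP (cid (quo_subproof i)). Qed.

Lemma quo_map_hom i : word_hom (@fs_op (quo i)) (@quo_map i).
Proof. by have [[]] := svalP (cid (quo_subproof i)). Qed.

Lemma quo_map_surj i y : exists w, quo_map i w = y.
Proof. by have [[]] := svalP (cid (quo_subproof i)). Qed.

Lemma quo_exists (S : finSemigroup) (phi : word A -> S) :
  V S -> word_hom (@fs_op S) phi ->
  exists i, forall u v, quo_map i u = quo_map i v <-> phi u = phi v.
Proof.
move=> VS hphi.
have [T [q [VT hq sq kq]]] := word_hom_image pV (inhabits a0) VS hphi.
have H : exists S, exists2 psi : word A -> fs_car S, word_quotient psi &
    forall u v, psi u = psi v <-> phi u = phi v by exists T, q.
exists (exist _ (fun u v => phi u = phi v) H).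
by have [] := svalP (cid (quo_subproof (exist _ (fun u v => phi u = phi v) H))).
Qed.

Definition quo_le i j : Prop :=
  forall u v, quo_map j u = quo_map j v -> quo_map i u = quo_map i v.

(** A word representing [y] is chosen; by [h] the result does not depend on the choice. *)
Definition quo_trans i j (h : quo_le i j) (y : quo j) : quo i :=
  quo_map i (sval (cid (quo_map_surj y))).

Lemma quo_transE i j (h : quo_le i j) w : quo_trans h (quo_map j w) = quo_map i w.
Proof. by apply: h; exact: svalP (cid (quo_map_surj _)). Qed.

Lemma quo_dir i j : exists k, quo_le i k /\ quo_le j k.
Proof.
have VP : V (prod_fs (quo i) (quo j)) by case: pV => _ _ _; apply; exact: quo_in.
have hP : word_hom (@fs_op (prod_fs (quo i) (quo j))) (fun w => (quo_map i w, quo_map j w)).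
  by move=> u v; rewrite !quo_map_hom.
have [k kP] := quo_exists VP hP.
by exists k; split=> u v /kP[].
Qed.

Definition free_car : Type := {t : forall i, quo i |
  forall i j (h : quo_le i j), quo_trans h (t j) = t i}.

Lemma free_car_inj (x y : free_car) : (forall i, sval x i = sval y i) -> x = y.
Proof.
case: x y => [x px] [y py] /= H.
have e : x = y by exact: functional_extensionality_dep.
subst y.
by congr exist; exact: Prop_irrelevance.
Qed.

Lemma quo_trans_hom i j (h : quo_le i j) : fs_hom (quo_trans h).
Proof.
move=> x y; have [u <-] := quo_map_surj x; have [v <-] := quo_map_surj y.
by rewrite -quo_map_hom !quo_transE quo_map_hom.
Qed.

Lemma free_car_op_subproof (x y : free_car) i j (h : quo_le i j) :
  quo_trans h (fs_op (sval x j) (sval y j)) = fs_op (sval x i) (sval y i).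
Proof. by rewrite quo_trans_hom (svalP x) (svalP y). Qed.

Definition free_car_op (x y : free_car) : free_car :=
  exist _ (fun i => fs_op (sval x i) (sval y i)) (free_car_op_subproof x y).

Lemma free_car_opA : associative free_car_op.
Proof. by move=> x y z; apply: free_car_inj => i; exact: fs_assoc. Qed.

Definition free_cone : cone V free_car_op.
Proof.
refine (@Cone V free_car free_car_op congruence quo_le quo quo_trans
  (fun i x => sval x i) _ _ _ _ _ _).
- split; [|by move=> i u v| |exact: quo_dir].
    have [T [phi [VT hphi _]]] := recognizableT pV A.
    by have [i _] := quo_exists VT hphi; exists.
  by move=> i j k ij jk u v /jk/ij.
- split; [exact: quo_in | exact: quo_trans_hom | |].
    by move=> i h y; have [w <-] := quo_map_surj y; rewrite quo_transE.
  by move=> i j k ij jk ik y; have [w <-] := quo_map_surj y; rewrite !quo_transE.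
- by [].
- by move=> i j h x; exact: (svalP x).
- exact: free_car_inj.
- by move=> t te; exists (exist _ t te).
Defined.

Definition free_ts : topSemigroup := cone_ts free_car_opA free_cone.

Definition free_word (w : word A) : free_ts :=
  exist (fun t : forall i, quo i => forall i j (h : quo_le i j), quo_trans h (t j) = t i)
    (fun i => quo_map i w) (fun i j h => quo_transE h w).

Lemma free_word_hom : word_hom (@ts_op free_ts) free_word.
Proof. by move=> u v; apply: free_car_inj => i; exact: quo_map_hom. Qed.

Definition free_iota (a : A) : free_ts := free_word (letter a).

Lemma free_ts_fiber (x : free_ts) i : \forall y \near x, sval y i = sval x i.
Proof. exact: (@cone_ts_fiber _ _ _ free_car_opA free_cone x i). Qed.

Lemma free_word_approx (x : free_ts) i : exists w, sval x i = quo_map i w.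
Proof. by have [w] := quo_map_surj (sval x i); exists w. Qed.

(** For each projection [l] of [T], the kernel of the induced map on words is an index [idx l]. The
    [l]-component of the image of [x] is the value of any word agreeing with [x] at [idx l]. *)
Lemma free_ts_free : free_proV V free_iota.
Proof.
split; first exact: cone_proV.
move=> T proT g.
have [d [cT open_fiber open_base]] := proV_cone proT.
pose gw := weval (@ts_op T) g.
have gw_hom : word_hom (@ts_op T) gw by apply: weval_hom; exact: ts_assoc.
have Vd l : V (cfs d l) by have [+ _ _ _] := c_system d; apply.
have dgw_hom l : word_hom (@fs_op _) (cpi d l \o gw).
  by move=> u v; rewrite /= gw_hom c_hom.
have [idx idxP] := choice (fun l => quo_exists (Vd l) (@dgw_hom l)).
have [rep repP] := choice (fun p : free_ts * cidx d => free_word_approx p.1 (idx p.2)).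
pose val (x : free_ts) l := cpi d l (gw (rep (x, l))).
have valE (x : free_ts) l w : sval x (idx l) = quo_map (idx l) w -> val x l = cpi d l (gw w).
  by move=> e; apply/(idxP l); rewrite -e; exact/esym/(repP (x, l)).
(* By directedness one word approximates [x] at two indices at once, so the components of the image
   form a thread. *)
have common (x : free_ts) i j : exists w, sval x i = quo_map i w /\ sval x j = quo_map j w.
  have [k [ik jk]] := quo_dir i j; have [w e] := free_word_approx x k.
  by exists w; rewrite -(svalP x i k ik) -(svalP x j k jk) e !quo_transE.
have thr x : exists y, forall l, cpi d l y = val x l.
  apply: c_thread => l m h.
  have [w [/valE -> /valE ->]] := common x (idx l) (idx m).
  exact: c_compat.
have [h hP] := choice thr.
have hw w : h (free_word w) = gw w.
  by apply: (c_inj (c := d)) => l; rewrite hP; exact: valE.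
exists h; split; first split.
- apply: (cone_continuous open_base) => l x; rewrite !hP.
  apply: filterS (free_ts_fiber x (idx l)) => y e; rewrite hP.
  by have [w ew] := free_word_approx x (idx l); rewrite !(valE _ _ w) ?e.
- move=> x y; apply: (c_inj (c := d)) => l; rewrite c_hom !hP.
  have [u eu] := free_word_approx x (idx l); have [v ev] := free_word_approx y (idx l).
  rewrite (valE x l u eu) (valE y l v ev) (valE _ l (wcat u v)).
    by rewrite gw_hom c_hom.
  by rewrite /= eu ev quo_map_hom.
- by move=> a; rewrite hw.
- move=> h' [h'c h'h h'a]; apply/funext => x; apply: (c_inj (c := d)) => l.
  rewrite hP.
  have h'w w : h' (free_word w) = gw w.
    move: w; apply: (word_hom_ext (phi := h' \o free_word) _ gw_hom) => //.
    by move=> u v; rewrite /= free_word_hom h'h.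
  (* Continuity gives a fibre around [x] on which the [l]-component of [h'] is constant; a word in
     it agreeing with [x] at [idx l] fixes the value. *)
  have /(h'c x) : nbhs (h' x) (cpi d l @^-1` [set cpi d l (h' x)]).
    exact: fiber_nbhs.
  rewrite nbhs_simpl /= => n1.
  have /cone_nbhsP [i iP] := n1.
  have [w [e1 e2]] := common x i (idx l).
  by rewrite (valE x l w e2) -h'w; have /= := iP (free_word w) (esym e1).
Qed.

End FreeConstruction.

(** The openness hypothesis speaks of given free objects, so one must be constructed. Over the empty
    alphabet there are no words, and any homomorphism recognizes any language. *)
Lemma open_mult_concat_closed (V : finSemigroup -> Prop) :
  pseudovariety V -> contains_N V ->
  (forall (A : finType) (F : topSemigroup) (iota : A -> F),
     free_proV V iota -> open_mult F) -> concat_closed V.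
Proof.
move=> pV VN openV A K L Krec Lrec.
have [[a0]|A0] := pselect (inhabited A); last first.
  have [F [phi [VF hphi _]]] := recognizableT pV A.
  by apply: (recognizable_by VF hphi) => -[a s]; case: A0.
have freeF := free_ts_free pV a0.
have [c [cF oF bF]] := proV_cone freeF.1.
exact: (open_mult_lcat pV freeF VN (openV _ _ _ freeF) a0 cF oF bF).
Qed.

Lemma concat_closed_open_mult (V : finSemigroup -> Prop) (A : Type)
    (F : topSemigroup) (iota : A -> F) :
  pseudovariety V -> concat_closed V -> free_proV V iota -> open_mult F.
Proof.
move=> pV /(concat_closed_allP pV) cc freeF.
have [c [cF oF bF]] := proV_cone freeF.1.
have [Aex|A0] := pselect (inhabited A).
  exact: (free_open_mult pV freeF cF oF bF).
by apply: (free_open_mult_empty freeF oF) => a; apply: A0.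
Qed.

Unset Implicit Arguments.

Theorem mainTheorem3 (V : finSemigroup -> Prop) :
  pseudovariety V ->
  [/\ concat_closed V <-> concat_closed_all V,
      concat_closed V <->
        (contains_N V /\
         forall (A : Type) (F : topSemigroup) (iota : A -> F),
           free_proV V iota -> open_mult F) &
      concat_closed V <->
        (contains_N V /\
         forall (A : finType) (F : topSemigroup) (iota : A -> F),
           free_proV V iota -> open_mult F)].
Proof.
move=> pV.
have from_open := @open_mult_concat_closed V pV.
split; first exact: concat_closed_allP.
- split=> [cc|[VN openV]]; last by apply: from_open => // A; exact: openV.
  split; first exact: concat_closed_contains_N.
  by move=> A F iota; exact: concat_closed_open_mult.
- split=> [cc|[VN openV]]; last exact: from_open.
  split; first exact: concat_closed_contains_N.
  by move=> A F iota; exact: concat_closed_open_mult.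
Qed.
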